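(* Let $G=(V,E)$ be a strongly connected $d$-out digraph, let $S=\langle R_1,\ldots,R_d\rangle$ be a coloring semigroup of $G$ with kernel $\mathcal K$, and let $W\in S$ and $B=\operatorname{range}(W)$. Then $B$ is an $F$-clique if and only if $W\in\mathcal K$.
   Context: A $d$-out digraph has every vertex of out-degree $d$ (multiple edges allowed). A coloring is a decomposition of the adjacency matrix $\mathcal A=R_1+\cdots+R_d$ into 0-1 stochastic matrices, each identified with a map $V\to V$ ($jR_i=k$ iff $(R_i)_{jk}=1$; maps act on the right). The coloring semigroup $S$ is the finite semigroup they generate under composition, and its kernel $\mathcal K$ is its minimal ideal. For $W\in S$, $\operatorname{range}(W)=\{xW: x\in V\}$. A set $B=\operatorname{range}(W)$ with $W\in S$ is an $F$-clique if for every pair $x\ne y$ in $B$ and every $U\in S$, $xU\ne yU$. *)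

(* Defs.v *)
From mathcomp Require Import all_boot all_order all_algebra.

Set Implicit Arguments.
Unset Strict Implicit.
Unset Printing Implicit Defensive.

Import GRing.Theory.
Local Open Scope ring_scope.

(* A digraph on the vertex set 'I_n; parallel edges and loops are allowed. *)
Record digraph (n : nat) := Digraph {
  edge : finType;
  source : edge -> 'I_n;
  target : edge -> 'I_n
}.

Definition out_regular (n d : nat) (G : digraph n) : Prop :=
  forall x : 'I_n, #|[set e : edge G | source e == x]| = d.

Definition edge_rel (n : nat) (G : digraph n) : rel 'I_n :=
  fun x y => [exists e : edge G, (source e == x) && (target e == y)].

Definition strongly_connected (n : nat) (G : digraph n) : Prop :=
  forall x y : 'I_n, connect (edge_rel G) x y.

Definition adjacency_mx (n : nat) (G : digraph n) : 'M[nat]_n :=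
  \matrix_(x, y) #|[set e : edge G | (source e == x) && (target e == y)]|.

Definition stochastic01 (n : nat) (M : 'M[nat]_n) : Prop :=
  (forall x y, M x y = 0 \/ M x y = 1) /\ (forall x, \sum_y M x y = 1).

Definition coloring (n d : nat) (G : digraph n) (R : 'I_d -> 'M[nat]_n) : Prop :=
  (forall i, stochastic01 (R i)) /\ adjacency_mx G = \sum_(i < d) R i.

(* The map V -> V identified with a 0-1 stochastic matrix: x is sent to the
   unique y with M x y = 1.  The default value x is used only when row x of M
   has no entry 1, which cannot happen for a stochastic M. *)
Definition map_of_mx (n : nat) (M : 'M[nat]_n) : {ffun 'I_n -> 'I_n} :=
  [ffun x => odflt x [pick y | M x y == 1]].

(* Maps act on the right: x (f g) = (x f) g. *)
Definition rcomp (n : nat) (f g : {ffun 'I_n -> 'I_n}) : {ffun 'I_n -> 'I_n} :=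
  [ffun x => g (f x)].

Definition comp_closed (n : nat) (T : {set {ffun 'I_n -> 'I_n}}) : bool :=
  [forall f in T, forall g in T, rcomp f g \in T].

(* The subsemigroup generated by A; the identity map is not added. *)
Definition generated_semigroup (n : nat) (A : {set {ffun 'I_n -> 'I_n}}) :
    {set {ffun 'I_n -> 'I_n}} :=
  \bigcap_(T : {set {ffun 'I_n -> 'I_n}} | (A \subset T) && comp_closed T) T.

Definition coloring_semigroup (n d : nat) (R : 'I_d -> 'M[nat]_n) :
    {set {ffun 'I_n -> 'I_n}} :=
  generated_semigroup [set map_of_mx (R i) | i : 'I_d].

(* Nonempty two-sided ideals of S. *)
Definition ideal (n : nat) (S I : {set {ffun 'I_n -> 'I_n}}) : bool :=
  [&& I != set0, I \subset S &
      [forall f in S, forall g in I, (rcomp f g \in I) && (rcomp g f \in I)]].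

Definition is_kernel (n : nat) (S K : {set {ffun 'I_n -> 'I_n}}) : bool :=
  minset (ideal S) K.

Definition range (n : nat) (W : {ffun 'I_n -> 'I_n}) : {set 'I_n} :=
  [set W x | x : 'I_n].

Definition F_clique (n : nat) (S : {set {ffun 'I_n -> 'I_n}})
    (B : {set 'I_n}) : Prop :=
  (exists2 W, W \in S & B = range W) /\
  (forall x y, x \in B -> y \in B -> x <> y ->
     forall U, U \in S -> U x <> U y).

(* Main.v *)
(* The kernel elements of rank at most r form an ideal if there are any, so all
   kernel elements have the same rank; hence every U in S is injective on the
   range of a kernel element.
   Conversely, if B = range W is an F-clique and k lies in the kernel, then
   U = kW maps into B and is injective on B, so f |-> fU is an injection of the
   finite set {f in S | range f is contained in B} into itself.  It is therefore
   onto; as it takes values in the kernel, W is in the kernel. *)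
Require Import Defs.
From mathcomp Require Import all_boot all_order all_algebra.

Section TransformationSemigroups.

#[local] Set Implicit Arguments.
#[local] Unset Strict Implicit.

Variable n : nat.
Implicit Types (f g U W : {ffun 'I_n -> 'I_n}) (A S K : {set {ffun 'I_n -> 'I_n}}).

Lemma range_rcomp f g : range (rcomp f g) = g @: range f.
Proof.
rewrite /range -imset_comp; apply: eq_imset => x /=.
by rewrite ffunE.
Qed.

Lemma range_rcomp_sub f g : range (rcomp f g) \subset range g.
Proof. by rewrite range_rcomp; apply: imsetS; apply/subsetP. Qed.

Lemma generated_semigroup_closed A f g :
  f \in generated_semigroup A -> g \in generated_semigroup A ->
  rcomp f g \in generated_semigroup A.
Proof.
move=> /bigcapP Sf /bigcapP Sg; apply/bigcapP => T T_A.
have /andP[_ /forall_inP T_closed] := T_A.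
exact: (forall_inP (T_closed f (Sf T T_A)) g (Sg T T_A)).
Qed.

Lemma idealP S K :
  reflect [/\ K != set0, {subset K <= S} &
             forall f g, f \in S -> g \in K -> rcomp f g \in K /\ rcomp g f \in K]
          (ideal S K).
Proof.
apply: (iffP and3P) => -[K0 KS HK]; split=> //; first exact/subsetP.
- move=> f g Sf Kg.
  by have /forall_inP/(_ g Kg)/andP := forall_inP HK f Sf.
- exact/subsetP.
- by apply/forall_inP => f Sf; apply/forall_inP => g Kg; apply/andP; apply: HK.
Qed.

Lemma kernel_rank_leq S K f g :
  is_kernel S K -> f \in K -> g \in K -> #|range f| <= #|range g|.
Proof.
move=> /minsetP[/idealP[_ KS HK] Kmin] Kf Kg.
pose J := [set h in K | #|range h| <= #|range g|].
have JK : J \subset K by apply/subsetP => h /setIdP[].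
suff idJ : ideal S J by move: Kf; rewrite -(Kmin J idJ JK) => /setIdP[].
apply/idealP; split.
- by apply/set0Pn; exists g; rewrite inE Kg leqnn.
- by move=> h /setIdP[/KS].
(* Precomposing shrinks the range and postcomposing replaces it by its image, so neither raises the
   rank. *)
- move=> u h Su /setIdP[Kh hg]; have [Kuh Khu] := HK u h Su Kh.
  rewrite !inE Kuh Khu; split=> /=; apply: leq_trans hg.
    exact: subset_leq_card (range_rcomp_sub u h).
  by rewrite range_rcomp; apply: leq_imset_card.
Qed.

(** As [rcomp W U] stays in [K], the image of [range W] under [U] is no smaller than [range W]; on a
    finite set this forces injectivity. *)
Lemma kernel_inj_on_range S K W U :
  is_kernel S K -> W \in K -> U \in S -> {in range W &, injective U}.
Proof.
move=> kerK KW SU; apply/imset_injP; rewrite eqn_leq leq_imset_card /=.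
rewrite -range_rcomp; apply: (kernel_rank_leq kerK KW).
by case/minsetP: kerK => /idealP[_ _ HK] _; case: (HK U W SU KW).
Qed.

Lemma inj_on_range_in_ideal S K W :
  {in S &, forall f g, rcomp f g \in S} -> ideal S K -> W \in S ->
  {in S, forall U, {in range W &, injective U}} -> W \in K.
Proof.
move=> S_closed /idealP[/set0Pn[k Kk] KS HK] SW injW.
(* The factor [k] puts [U] in the ideal; the factor [W] puts its range inside [range W]. *)
pose U := rcomp k W; have KU : U \in K by case: (HK W k SW Kk).
pose X := [set f in S | range f \subset range W].
pose mulU f := rcomp f U.
(* Elements of [X] take values in [range W], where [U] is injective, so [U] cancels on the right. *)
have injU : {in X &, injective mulU}.
  move=> f g /setIdP[_ /subsetP fW] /setIdP[_ /subsetP gW] /ffunP fgU.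
  apply/ffunP => x; apply: (injW U (KS U KU)).
  - exact/fW/imset_f.
  - exact/gW/imset_f.
  - by have := fgU x; rewrite !ffunE.
have XU : mulU @: X \subset X.
  apply/subsetP => _ /imsetP[f /setIdP[Sf _] ->].
  rewrite inE (S_closed _ _ Sf (KS U KU)) /=.
  exact: subset_trans (range_rcomp_sub f U) (range_rcomp_sub k W).
have XE : mulU @: X = X.
  by apply/eqP; rewrite eqEcard XU card_in_imset /=.
(* By surjectivity [W] is some [rcomp f U] with [f] in [S], which the ideal absorbs. *)
have : W \in X by rewrite inE SW subxx.
rewrite -XE => /imsetP[f /setIdP[Sf _] ->].
by case: (HK f U Sf KU).
Qed.

End TransformationSemigroups.

Theorem mainTheorem4 (n d : nat) (G : digraph n) (R : 'I_d -> 'M[nat]_n)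
    (K : {set {ffun 'I_n -> 'I_n}}) (W : {ffun 'I_n -> 'I_n})
    (B : {set 'I_n}) :
  out_regular d G ->
  strongly_connected G ->
  coloring G R ->
  is_kernel (coloring_semigroup R) K ->
  W \in coloring_semigroup R ->
  B = range W ->
  F_clique (coloring_semigroup R) B <-> W \in K.
Proof.
move=> _ _ _ kerK SW ->; split=> [[_ injW] | KW].
- apply: (inj_on_range_in_ideal _ (minsetp kerK) SW).
    by move=> f g; apply: generated_semigroup_closed.
  move=> U SU x y Wx Wy Uxy; apply/eqP/negPn/negP => /eqP neq_xy.
  exact: injW Wx Wy neq_xy U SU Uxy.
- split; first by exists W.
  move=> x y Wx Wy neq_xy U SU Uxy.
  exact/neq_xy/(kernel_inj_on_range kerK KW SU).
Qed.
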